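(* Let $\kappa$ be an integer with $0\le\kappa<1/\alpha$ and define $$\mathfrak{A}=\{A\subseteq V: A\text{ is isoperimetrically optimal with }|A|=s^*-1\},$$ $$\mathfrak{C}=\{C\subseteq V: C\text{ is isoperimetrically optimal with }|C|=s^*+\kappa\},$$ and let $\mathfrak{B}$ be the family of all $B\subseteq V$ for which there exists an isoperimetric progression $B_0,B_1,\dots,B_n$ with $B_0\in\mathfrak{A}$, $B_n\in\mathfrak{C}$, $B_1=B$ and $s^*-1<|B_i|<s^*+\kappa$ for $0<i<n$. Suppose that: (1) $|U|<(1+\alpha)|V|$; (2) there exists an isoperimetric numbering of length at least $\tilde s$; (3) $s^*$ is the unique maximiser of $g(s)=\Delta(s)-\alpha(s-1)$ in $\{0,1,\dots,\tilde s\}$; (4) $\Delta(s^*+\kappa)\ge\Delta(s^*+\kappa-1)$; $\Delta(s^*+i)\ge\Delta(s^* )$ for $0\le i<\kappa$; and $\Delta(s^* )=\Delta(s^*-1)+1$; (5) for each $A\in\mathfrak{A}$, there is an isoperimetric progression from $\varnothing$ to $A$ consisting only of sets of size at most $s^*-1$; and for each $C\in\mathfrak{C}$, there is an isoperimetric progression from $C$ to a set of size $\tilde s$ consisting only of sets of size at least $s^*$. Then the families $\mathfrak{A}$ and $\mathfrak{B}$ satisfy the following: (a) the elements of $\mathfrak{A}$ and $\mathfrak{B}$ are isoperimetrically optimal, with $|A|=s^*-1$ for each $A\in\mathfrak{A}$ and $|B|=s^*$ for each $B\in\mathfrak{B}$; (b) for each $A\in\mathfrak{A}$, there is an isoperimetric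 progression from $\varnothing$ to $A$ consisting only of sets of size at most $s^*-1$; (c) for each $B\in\mathfrak{B}$, there is an isoperimetric progression from $B$ to a set of size $\tilde s$ consisting only of sets of size at least $s^*$; (d) for every $\alpha$-bounded progression $A_0,A_1,\dots,A_n$ with $A_0=\varnothing$ and $\Delta(A_n)\le\alpha|A_n|$, there is an index $0\le k<n$ such that $A_k\in\mathfrak{A}$ and $A_{k+1}\in\mathfrak{B}$.
   Context: Let $G=(U,V,E)$ be a finite, simple, undirected, connected bipartite graph with non-empty parts $U,V$ (every edge has one endpoint in $U$ and one in $V$), and fix $0<\alpha<1$. For $A\subseteq V$, $N(A)\subseteq U$ is the set of neighbours of elements of $A$, $\Delta(A)=|N(A)|-|A|$, and $\Delta(s)=\inf\{\Delta(A):A\subseteq V,|A|=s\}$. A set $A\subseteq V$ is isoperimetrically optimal if $\Delta(A)=\Delta(|A|)$. An isoperimetric numbering of length $n$ is a sequence $a_1,\dots,a_n$ of distinct elements of $V$ such that $\{a_1,\dots,a_i\}$ is isoperimetrically optimal for each $1\le i\le n$. The critical size $s^*$ is the smallest positive integer (in $\{1,\dots,|V|\}$) maximising $g(s)=\Delta(s)-\alpha(s-1)$. The resettling size $\tilde s$ is the smallest integer larger than $s^*$ such that $\Delta(\tilde s)\le\alpha\tilde s$. A progression from $A_0$ to $A_n$ is a sequence $A_0,A_1,\dots,A_n$ of subsets of $V$ with $|A_i\triangle A_{i+1}|=1$ for each $0\le i<n$. It is isoperimetric if every $A_i$ ($0\le i\le n$) is isoperimetrically optimal. It is $\alpha$-bounded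 if $\Delta(A_i)-\alpha|A_i|\le\Delta(s^* )-\alpha s^*$ for each $0\le i\le n$.
   Formalization: In (d) the progression is additionally required to end in a set with |A_n| ≥ s*+κ; as printed (d) fails for the trivial progression n=0, A_0=∅, and can fail when s̃ ≤ |A_n| < s*+κ. *)

(* Defs.v *)
From HB Require Import structures.
From mathcomp Require Import all_boot all_order all_algebra.
From mathcomp Require Import boolp classical_sets reals constructive_ereal ereal.

Set Implicit Arguments.
Unset Strict Implicit.
Unset Printing Implicit Defensive.

Import Order.TTheory GRing.Theory Num.Theory.
Local Open Scope ring_scope.

(* A finite simple bipartite graph with parts U and V is a relation
   [E : U -> V -> bool]; its vertex set is the disjoint sum U + V. *)
Definition bip_adj (U V : finType) (E : U -> V -> bool) : rel (U + V) :=
  fun x y => match x, y with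
             | inl u, inr v => E u v
             | inr v, inl u => E u v
             | _, _ => false
             end.

Definition bip_connected (U V : finType) (E : U -> V -> bool) : Prop :=
  forall x y : U + V, connect (bip_adj E) x y.

Definition neighbours (U V : finType) (E : U -> V -> bool) (A : {set V}) :
    {set U} :=
  [set u | [exists v in A, E u v]].

Definition Delta (R : realType) (U V : finType) (E : U -> V -> bool)
    (A : {set V}) : R :=
  #|neighbours E A|%:R - #|A|%:R.

(* The infimum over the sets of a given size is taken in the extended reals,
   so that it is +oo (infimum of the empty set) for s > |V|. *)
Definition Delta_size (R : realType) (U V : finType) (E : U -> V -> bool)
    (s : nat) : \bar R :=
  ereal_inf [set (Delta R E A)%:E | A in [set A : {set V} | #|A| = s]]%classic.

Definition optimal (R : realType) (U V : finType) (E : U -> V -> bool)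
    (A : {set V}) : Prop :=
  (Delta R E A)%:E = Delta_size R E #|A|.

Definition optimal_of_size (R : realType) (U V : finType) (E : U -> V -> bool)
    (s : nat) (A : {set V}) : Prop :=
  optimal R E A /\ #|A| = s.

Definition isoperimetric_numbering (R : realType) (U V : finType)
    (E : U -> V -> bool) (a : seq V) : Prop :=
  uniq a /\
  forall i : nat, (1 <= i <= size a)%N -> optimal R E [set x in take i a].

Definition gfun (R : realType) (alpha : R) (U V : finType)
    (E : U -> V -> bool) (s : nat) : \bar R :=
  (Delta_size R E s - (alpha * (s%:R - 1))%:E)%E.

Definition maximiser (R : realType) (g : nat -> \bar R) (P : pred nat)
    (s : nat) : Prop :=
  P s /\ forall t : nat, P t -> (g t <= g s)%E.

Definition unique_maximiser (R : realType) (g : nat -> \bar R) (P : pred nat)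
    (s : nat) : Prop :=
  maximiser g P s /\ forall t : nat, maximiser g P t -> t = s.

Definition critical_size (R : realType) (alpha : R) (U V : finType)
    (E : U -> V -> bool) (s : nat) : Prop :=
  let P := [pred t : nat | (1 <= t <= #|V|)%N] in
  maximiser (gfun alpha E) P s /\
  forall t : nat, maximiser (gfun alpha E) P t -> (s <= t)%N.

Definition resettling_size (R : realType) (alpha : R) (U V : finType)
    (E : U -> V -> bool) (scrit st : nat) : Prop :=
  [/\ (scrit < st)%N,
      (Delta_size R E st <= (alpha * st%:R)%:E)%E
    & forall t : nat, (scrit < t)%N ->
        (Delta_size R E t <= (alpha * t%:R)%:E)%E -> (st <= t)%N].

Definition symdiff (V : finType) (A B : {set V}) : {set V} :=
  (A :\: B) :|: (B :\: A).

(* A progression A_0, ..., A_n is the restriction to {0, ..., n} of a function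
   on nat; the values beyond n are irrelevant. *)
Definition progression (V : finType) (n : nat) (A : nat -> {set V}) : Prop :=
  forall i : nat, (i < n)%N -> #|symdiff (A i) (A i.+1)| = 1%N.

Definition isoperimetric_progression (R : realType) (U V : finType)
    (E : U -> V -> bool) (n : nat) (A : nat -> {set V}) : Prop :=
  progression n A /\ forall i : nat, (i <= n)%N -> optimal R E (A i).

Definition bounded_progression (R : realType) (alpha : R) (U V : finType)
    (E : U -> V -> bool) (scrit : nat) (n : nat) (A : nat -> {set V}) : Prop :=
  progression n A /\
  forall i : nat, (i <= n)%N ->
    ((Delta R E (A i) - alpha * #|A i|%:R)%:E
       <= Delta_size R E scrit - (alpha * scrit%:R)%:E)%E.

Definition famA (R : realType) (U V : finType) (E : U -> V -> bool)
    (scrit : nat) : {set V} -> Prop :=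
  optimal_of_size R E scrit.-1.

Definition famC (R : realType) (U V : finType) (E : U -> V -> bool)
    (scrit kappa : nat) : {set V} -> Prop :=
  optimal_of_size R E (scrit + kappa).

Definition famB (R : realType) (U V : finType) (E : U -> V -> bool)
    (scrit kappa : nat) (B : {set V}) : Prop :=
  exists (n : nat) (S : nat -> {set V}),
    (1 <= n)%N /\
    isoperimetric_progression R E n S /\
    famA R E scrit (S 0%N) /\
    famC R E scrit kappa (S n) /\
    S 1%N = B /\
    (forall i : nat, (0 < i < n)%N ->
       (scrit.-1 < #|S i| < scrit + kappa)%N).

(* There is an isoperimetric progression from A to a set satisfying T, all of
   whose members have a size satisfying P. *)
Definition isop_reaches (R : realType) (U V : finType) (E : U -> V -> bool)
    (P : pred nat) (A : {set V}) (T : {set V} -> Prop) : Prop :=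
  exists (n : nat) (S : nat -> {set V}),
    [/\ isoperimetric_progression R E n S, S 0%N = A, T (S n)
      & forall i : nat, (i <= n)%N -> P #|S i|].

(* Main.v *)
(* Write s for the critical size.  Sizes along a progression change by exactly
   one, so a progression from the empty set to a set of size at least s + kappa
   contains a stretch from size s - 1 to size s + kappa whose intermediate sizes
   lie strictly between the two.  Since alpha * kappa < 1 and Delta is
   integer-valued, alpha-boundedness forces Delta(A_i) <= Delta(s) on this
   stretch after its first set, and Delta(A_i) <= Delta(s) - 1 on the first one.
   By hypothesis (4) these are the minimal values for the sizes concerned, so
   the stretch is isoperimetric and witnesses membership in the family B. *)
Require Import Defs.
From HB Require Import structures.
From mathcomp Require Import all_boot all_order all_algebra.
From mathcomp Require Import reals constructive_ereal ereal.
From mathcomp Require Import zify lra.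

Set Implicit Arguments.
Unset Strict Implicit.
Unset Printing Implicit Defensive.

Import Order.TTheory GRing.Theory Num.Theory.
Local Open Scope ring_scope.

(** * Sizes along a progression *)

Lemma card_symdiff (V : finType) (A B : {set V}) :
  #|symdiff A B| = (#|A :\: B| + #|B :\: A|)%N.
Proof.
rewrite /symdiff cardsU [X in (_ - X)%N](_ : _ = 0%N) ?subn0 //.
apply/eqP; rewrite cards_eq0; apply/eqP/setP => x; rewrite !inE.
by case: (x \in A); case: (x \in B).
Qed.

Lemma card_symdiff1 (V : finType) (A B : {set V}) :
  #|symdiff A B| = 1%N -> #|B| = #|A|.+1 \/ #|A| = #|B|.+1.
Proof.
rewrite card_symdiff => AB1.
have := cardsID B A; have := cardsID A B; rewrite setIC; lia.
Qed.

(** A discrete intermediate value argument: [m] is the first index with [f m >= b], and [k] the last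
    index before [m] with [f k <= a]. Only upward jumps need a bound. *)
Lemma crossing_stretch (f : nat -> nat) (n a b : nat) :
    (forall i, (i < n)%N -> (f i.+1 <= (f i).+1)%N) ->
    (f 0 <= a)%N -> (a < b)%N -> (b <= f n)%N ->
  exists k m, [/\ (k < m <= n)%N, f k = a, f m = b
    & forall i, (k < i < m)%N -> (a < f i < b)%N].
Proof.
move=> step f0 ab fn.
have exm : exists m, (b <= f m)%N by exists n.
case: (ex_minnP exm) => m bm minm.
have mn : (m <= n)%N by exact: minm.
have m0 : (0 < m)%N by case: m bm {minm mn} => // bm; lia.
have exk : exists k, (k < m)%N && (f k <= a)%N by exists 0%N; rewrite m0.
have ubk k : (k < m)%N && (f k <= a)%N -> (k <= m)%N by case/andP => /ltnW.
case: (ex_maxnP exk ubk) => k /andP[km fk] maxk.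
have lo i : (k < i < m)%N -> (a < f i)%N.
  case/andP => ki im; rewrite ltnNge; apply/negP => fi.
  by have := maxk i; rewrite im fi /= => /(_ isT); lia.
have hi i : (i < m)%N -> (f i < b)%N.
  by move=> im; rewrite ltnNge; apply/negP => /minm; lia.
exists k, m; split=> //.
- by rewrite km mn.
(* The value after [k] exceeds [a], by maximality of [k] or because [k.+1 = m]; an increase of at
   most one then forces [f k = a]. *)
- have := step k (leq_trans km mn).
  have [km1|mk] := ltnP k.+1 m; first by have := lo k.+1; lia.
  have -> : k.+1 = m by lia.
  lia.
- by have := step m.-1; have := hi m.-1; rewrite prednK //; lia.
- by move=> i kim; rewrite lo // hi //; case/andP: kim.
Qed.

(** * Optimal sets and isoperimetric progressions *)

Section Isoperimetry.
Variables (R : realType) (U V : finType) (E : U -> V -> bool).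

Lemma Delta_size_le (A : {set V}) :
  (Delta_size R E #|A| <= (Delta R E A)%:E)%E.
Proof. by apply: ereal_inf_lbound; exists A. Qed.

Lemma optimal_le (A : {set V}) :
  ((Delta R E A)%:E <= Delta_size R E #|A|)%E -> optimal R E A.
Proof. by move=> le; apply/eqP; rewrite eq_le le Delta_size_le. Qed.

Lemma exists_optimal (s : nat) : (s <= #|V|)%N ->
  exists A : {set V}, optimal_of_size R E s A.
Proof.
move=> sV.
have [A0 A0s] : exists A0 : {set V}, #|A0| == s.
  have : (0 < #|[set A : {set V} | #|A| == s]|)%N by rewrite card_draws bin_gt0.
  by case/card_gt0P => A; rewrite inE; exists A.
(* At fixed size, minimising [Delta] amounts to minimising the number of neighbours. *)
case: (arg_minnP (P := fun A : {set V} => #|A| == s)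
  (fun A => #|neighbours E A|) A0s) => A /eqP As minA.
exists A; split=> //; apply: optimal_le; apply: le_ereal_inf_tmp => _ [B BA <-].
rewrite lee_fin /Delta BA lerD2r ler_nat; apply: minA.
by rewrite BA As.
Qed.

Lemma Delta_int (A : {set V}) :
  Delta R E A = (#|neighbours E A|%:Z - #|A|%:Z)%:~R.
Proof. by rewrite rmorphB. Qed.

Lemma Delta_lt_add1 (A B : {set V}) :
  Delta R E A < Delta R E B + 1 -> Delta R E A <= Delta R E B.
Proof. by rewrite !Delta_int -[1]/(1%:~R) -rmorphD /= ltr_int ler_int ltzD1. Qed.

Lemma isop_progression_drop (n k : nat) (S : nat -> {set V}) :
    (k <= n)%N -> isoperimetric_progression R E n S ->
  isoperimetric_progression R E (n - k) (fun i => S (i + k)%N).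
Proof.
by move=> kn [prog opt]; split=> i ink; [apply: prog|apply: opt]; lia.
Qed.

Lemma isop_reaches_trans (P : pred nat) (A : {set V}) (T T' : {set V} -> Prop) :
    isop_reaches R E P A T ->
    (forall C, T C -> isop_reaches R E P C T') ->
  isop_reaches R E P A T'.
Proof.
case=> n [S [[progS optS] S0 TS PS]].
move=> /(_ _ TS)[m [S' [[progS' optS'] S'0 TS' PS']]].
(* The two progressions are glued at index [n], where [S n = S' 0]. *)
pose W i := if (i <= n)%N then S i else S' (i - n)%N.
have WD i : W (n + i)%N = S' i.
  rewrite /W; case: leqP => [|_]; last by rewrite addKn.
  by case: i => [|i]; rewrite ?addn0 ?S'0 //; lia.
have W_le i : (i <= n)%N -> W i = S i by rewrite /W => ->.
exists (n + m)%N, W; split; [split| | |].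
- move=> i inm; have [lt_in|le_ni] := ltnP i n.
    by rewrite !W_le ?(ltnW lt_in) //; exact: progS.
  by rewrite -(subnKC le_ni) -addnS !WD; apply: progS'; lia.
- move=> i inm; have [le_in|/ltnW le_ni] := leqP i n.
    by rewrite W_le //; exact: optS.
  by rewrite -(subnKC le_ni) WD; apply: optS'; lia.
- by rewrite W_le.
- by rewrite WD.
- move=> i inm; have [le_in|/ltnW le_ni] := leqP i n.
    by rewrite W_le //; exact: PS.
  by rewrite -(subnKC le_ni) WD; apply: PS'; lia.
Qed.

(** One step from size [scrit.-1] goes up or down. Going down is excluded by the lower bound on
    intermediate sizes, or, when [n = 1], by the final size [scrit + kappa]. *)
Lemma famB_optimal_of_size (scrit kappa : nat) (B : {set V}) :
  (0 < scrit)%N -> famB R E scrit kappa B -> optimal_of_size R E scrit B.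
Proof.
move=> s0 [n [S [n1 [[prog opt] [[_ cA] [[_ cC] [<- mid]]]]]]].
split; first exact: opt.
have step1 := card_symdiff1 (prog 0%N n1).
have [n_gt1|n_le1] := ltnP 1 n; first by have := mid 1%N; lia.
have n1E : n = 1%N by lia.
by rewrite n1E in cC; lia.
Qed.

Lemma famB_reaches_famC (scrit kappa : nat) (B : {set V}) :
    (0 < scrit)%N -> famB R E scrit kappa B ->
  isop_reaches R E (fun s => scrit <= s)%N B (famC R E scrit kappa).
Proof.
move=> s0 [n [S [n1 [isoS [_ [CS [<- mid]]]]]]].
exists n.-1, (fun i => S (i + 1)%N); split=> //.
- by rewrite -subn1; exact: isop_progression_drop.
- by rewrite addn1 prednK.
- move=> i in1; have [lt_in|le_ni] := ltnP (i + 1) n.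
    by have := mid (i + 1)%N; lia.
  have -> : (i + 1 = n)%N by lia.
  by case: CS => _ ->; rewrite leq_addr.
Qed.

End Isoperimetry.

(** * Bounded sets of near-critical size *)

Section BoundedSets.
Variables (R : realType) (alpha : R) (U V : finType) (E : U -> V -> bool).
Variables (scrit kappa : nat) (B : {set V}).
Hypotheses (alpha_gt0 : 0 < alpha) (kappa_lt : kappa%:R < alpha^-1).
Hypotheses (scrit_gt0 : (0 < scrit)%N) (B_opt : optimal_of_size R E scrit B).

(** The witness [B] makes the infimum finite, so that the bounds become real inequalities. *)
Let Delta_scrit : Delta_size R E scrit = (Delta R E B)%:E.
Proof. by case: B_opt => + <- => <-. Qed.

(** Boundedness gives [Delta A <= Delta B + alpha * kappa < Delta B + 1]; integrality removes the
    excess. *)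
Lemma bounded_optimal (A : {set V}) :
    ((Delta R E A - alpha * #|A|%:R)%:E
       <= Delta_size R E scrit - (alpha * scrit%:R)%:E)%E ->
    (scrit <= #|A| <= scrit + kappa)%N ->
    (Delta_size R E scrit <= Delta_size R E #|A|)%E ->
  optimal R E A.
Proof.
rewrite Delta_scrit -EFinB lee_fin => bA /andP[sA As] ge.
apply: optimal_le; apply: le_trans ge; rewrite lee_fin; apply: Delta_lt_add1.
have ak1 : alpha * kappa%:R < 1 by rewrite -ltr_pdivlMl // mulr1.
have : alpha * #|A|%:R <= alpha * (scrit + kappa)%:R :> R.
  by rewrite ler_pM2l // ler_nat.
rewrite natrD mulrDr; lra.
Qed.

(** Being one element smaller costs [alpha]: [Delta A <= Delta B - alpha < Delta A' + 1] for an
    optimal [A'] of the same size as [A], and integrality concludes. *)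
Lemma bounded_optimal_pred (A : {set V}) :
    ((Delta R E A - alpha * #|A|%:R)%:E
       <= Delta_size R E scrit - (alpha * scrit%:R)%:E)%E ->
    #|A| = scrit.-1 ->
    Delta_size R E scrit = (Delta_size R E scrit.-1 + 1%:E)%E ->
  optimal R E A.
Proof.
rewrite Delta_scrit -EFinB lee_fin => bA As jump.
have [A' [A'opt A's]] : exists A', optimal_of_size R E scrit.-1 A'.
  by apply: exists_optimal; rewrite -As max_card.
move: jump; rewrite -A's -A'opt -EFinD => -[jump].
apply: optimal_le; rewrite As -A's -A'opt lee_fin; apply: Delta_lt_add1.
have scritE : scrit%:R = scrit.-1%:R + 1 :> R by rewrite natr1 prednK.
move: bA; rewrite jump As scritE mulrDr mulr1.
by move: alpha_gt0; lra.
Qed.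

End BoundedSets.

Theorem proposition1p4 (R : realType) (alpha : R)
    (U V : finType) (E : U -> V -> bool) (scrit st kappa : nat)
    (halpha : 0 < alpha < 1)
    (hU : (0 < #|U|)%N) (hV : (0 < #|V|)%N) (hconn : bip_connected E)
    (hscrit : critical_size alpha E scrit)
    (hst : resettling_size alpha E scrit st)
    (hkappa : kappa%:R < alpha^-1)
    (h1 : #|U|%:R < (1 + alpha) * #|V|%:R)
    (h2 : exists a : seq V, isoperimetric_numbering R E a /\ (st <= size a)%N)
    (h3 : unique_maximiser (gfun alpha E) [pred s : nat | (s <= st)%N] scrit)
    (h4a : (Delta_size R E (scrit + kappa).-1
              <= Delta_size R E (scrit + kappa))%E)
    (h4b : forall i : nat, (i < kappa)%N ->
             (Delta_size R E scrit <= Delta_size R E (scrit + i))%E)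
    (h4c : Delta_size R E scrit = (Delta_size R E scrit.-1 + 1%:E)%E)
    (h5a : forall A : {set V}, famA R E scrit A ->
             isop_reaches R E (fun s => s <= scrit.-1)%N set0 (fun T => T = A))
    (h5b : forall C : {set V}, famC R E scrit kappa C ->
             isop_reaches R E (fun s => scrit <= s)%N C
               (fun T => #|T| = st)) :
  ((forall A : {set V}, famA R E scrit A ->
      optimal R E A /\ #|A| = scrit.-1) /\
   (forall B : {set V}, famB R E scrit kappa B ->
      optimal R E B /\ #|B| = scrit)) /\
  (forall A : {set V}, famA R E scrit A ->
     isop_reaches R E (fun s => s <= scrit.-1)%N set0 (fun T => T = A)) /\
  (forall B : {set V}, famB R E scrit kappa B ->
     isop_reaches R E (fun s => scrit <= s)%N B (fun T => #|T| = st)) /\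
  (forall (n : nat) (A : nat -> {set V}),
     bounded_progression alpha E scrit n A ->
     A 0%N = set0 ->
     Delta R E (A n) <= alpha * #|A n|%:R ->
     (scrit + kappa <= #|A n|)%N ->
     exists k : nat,
       (k < n)%N /\ famA R E scrit (A k) /\ famB R E scrit kappa (A k.+1)).
Proof.
case/andP: halpha => a0 _.
case: hscrit => -[/andP[s0 sV] _] _.
have [B Bopt] := exists_optimal R E sV.
split; [split=> //|split; [exact: h5a|split]].
- by move=> B'; apply: famB_optimal_of_size.
- move=> B' B'B; apply: isop_reaches_trans (famB_reaches_famC s0 B'B) _.
  exact: h5b.
(* [An] provides the upper level to be crossed; it also excludes the one-term progression at the
   empty set. *)
move=> n A [prog bnd] A0 _ An.
have [|||k [m [/andP[km mn] cAk cAm mid]]] :=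
    @crossing_stretch (fun i => #|A i|) n scrit.-1 (scrit + kappa) _ _ _ An.
- by move=> i /prog/card_symdiff1; lia.
- by rewrite A0 cards0.
- lia.
have optk : optimal R E (A k).
  have kn : (k <= n)%N by apply: ltnW; exact: leq_trans km mn.
  exact (bounded_optimal_pred a0 s0 Bopt (bnd k kn) cAk h4c).
have optm : optimal R E (A m).
  refine (bounded_optimal a0 hkappa Bopt (bnd m mn) _ _).
    by rewrite cAm; lia.
  (* The top size is reached through its predecessor, [scrit + kappa.-1], which [h4b] covers when
     [kappa > 0]. *)
  rewrite cAm; case: (posnP kappa) => [->|k0]; first by rewrite addn0.
  apply: le_trans h4a; rewrite -(prednK k0) addnS /=; apply: h4b; lia.
have opt i : (k <= i <= m)%N -> optimal R E (A i).
  rewrite leq_eqVlt => /andP[/predU1P[<- //|ki]].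
  rewrite leq_eqVlt => /predU1P[-> //|im].
  have kim : (scrit.-1 < #|A i| < scrit + kappa)%N by apply: mid; rewrite ki im.
  refine (bounded_optimal a0 hkappa Bopt (bnd i _) _ _); [lia|lia|].
  have -> : #|A i| = (scrit + (#|A i| - scrit))%N by lia.
  by apply: h4b; lia.
exists k; split; first exact: leq_trans km mn.
split=> //.
(* The stretch from [k] to [m], reindexed from 0, has [A k.+1] at index 1. *)
exists (m - k)%N, (fun i => A (i + k)%N); split; first by lia.
split; first by split=> i imk; [apply: prog|apply: opt]; lia.
rewrite subnK ?(ltnW km) //; do 3!split=> //.
by move=> i ik; apply: mid; lia.
Qed.
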